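(* Let $\mathcal{M}$ be the set of isometry classes of compact metric spaces, endowed with the Gromov-Hausdorff distance $d_{\mathcal{GH}}$. The map $$(\mathcal{M},d_{\mathcal{GH}})\to[0,+\infty],\qquad E\mapsto\beta_E,$$ where $\beta_E$ is the fractional index of $E$, is not continuous at $E=\mathbb{S}^1$.
   Context: $\mathbb{S}^1$ is the circle of length $2\pi$ endowed with its geodesic distance $d_{\mathbb{S}^1}(\theta_1,\theta_2)=\min(|\theta_1-\theta_2|,2\pi-|\theta_1-\theta_2|)$. The Hausdorff distance between closed subsets $A,B$ of a metric space $(X,d)$ is $d_{\mathcal{H}}(A,B)=\max\{\sup_{x\in A}d(x,B),\sup_{y\in B}d(y,A)\}$. The Gromov-Hausdorff distance between isometry classes of compact metric spaces with representatives $E,F$ is $d_{\mathcal{GH}}(E,F)=\inf_{i,j}d_{\mathcal{H}}(i(E),j(F))$, where $i,j$ run through all isometric embeddings of $E$ and $F$ into any common ambient metric space $(X,d)$. A symmetric function $f:S\times S\to\mathbb{R}$ on a set $S$ is a negative definite kernel if for every $n$, every $x_1,\dots,x_n\in S$ and every $c_1,\dots,c_n\in\mathbb{R}$ with $\sum_{i=1}^n c_i=0$, one has $\sum_{i,j=1}^n c_ic_jf(x_i,x_j)\le 0$. The fractional index of a metric space $(E,d)$ is the number $\beta_E\in[0,+\infty]$ (known to exist, and depending only on the isometry class of $E$) such that for every $H>0$, the function $d^{2H}$ is a negative definite kernel if and only if $2H\le\beta_E$. The set $[0,+\infty]$ carries its usual topology. *)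

(* Defs.v *)
From HB Require Import structures.
From mathcomp Require Import all_boot all_order all_algebra.
From mathcomp Require Import all_classical all_reals all_analysis.
From mathcomp Require Import lra.

Set Implicit Arguments.
Unset Strict Implicit.
Unset Printing Implicit Defensive.

Import Order.TTheory GRing.Theory Num.Theory.
Import numFieldNormedType.Exports numFieldTopology.Exports.

Local Open Scope classical_set_scope.
Local Open Scope ring_scope.

(* Compact metric spaces are taken to be nonempty, as is usual for the
   Gromov-Hausdorff distance. *)
Record compactMetric (R : realType) := CompactMetric {
  cms_space :> metricType R ;
  cms_nonempty : [set: cms_space] !=set0 ;
  cms_compact : compact [set: cms_space] }.

Section IsometryClasses.
Variable R : realType.

Definition isometry (E F : metricType R) (f : E -> F) : Prop :=
  forall x y, mdist (f x) (f y) = mdist x y.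

Definition isometric (E F : metricType R) : Prop :=
  exists2 f : E -> F, isometry f & bijective f.

Lemma isometric_refl (E : metricType R) : isometric E E.
Proof. by exists id => //; exists id. Qed.

Lemma isometric_sym (E F : metricType R) : isometric E F -> isometric F E.
Proof.
move=> [f fi [g fK gK]]; exists g; last by exists f.
by move=> x y; rewrite -fi !gK.
Qed.

Lemma isometric_trans (E F G : metricType R) :
  isometric E F -> isometric F G -> isometric E G.
Proof.
move=> [f fi fb] [g gi gb].
by exists (g \o f); [move=> x y /=; rewrite gi fi | exact: bij_comp].
Qed.

Record isometryClass := IsometryClass {
  members :> compactMetric R -> Prop ;
  membersP : exists E : compactMetric R, members = fun F => isometric E F }.

Definition class_of (E : compactMetric R) : isometryClass :=
  @IsometryClass (fun F => isometric E F) (ex_intro _ E erefl).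

Lemma class_of_eq (E F : compactMetric R) :
  class_of E = class_of F <-> isometric E F.
Proof.
split=> [EF|EF].
  have : class_of E F by rewrite EF; exact: isometric_refl.
  by [].
rewrite /class_of; set p := ex_intro _ E _; move: p.
have -> : (fun G : compactMetric R => isometric E G) =
          (fun G : compactMetric R => isometric F G).
  apply/funext => G; apply/propext; split; last exact: isometric_trans.
  by apply: isometric_trans; exact: isometric_sym.
by move=> p; congr IsometryClass; exact: Prop_irrelevance.
Qed.

Definition representative (C : isometryClass) : compactMetric R :=
  projT1 (cid (membersP C)).

Lemma representative_class_of (E : compactMetric R) :
  isometric E (representative (class_of E)).
Proof.
rewrite /representative; case: cid => F /= /(congr1 (@^~ F)) ->.
exact: isometric_refl.
Qed.

Lemma edistE (X : metricType R) (x y : X) : edist (x, y) = (mdist x y)%:E.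
Proof.
apply/eqP; rewrite eq_le; apply/andP; split.
  apply/lee_addgt0Pr => e e0; apply: edist_fin; first by rewrite ltr_wpDl// mdist_ge0.
  by rewrite /= ballEmdist /= ltrDl.
apply: le_ereal_inf_tmp => _ [r [r0 /= xyr] <-].
by rewrite lee_fin; move: xyr; rewrite ballEmdist => /ltW.
Qed.

Definition hausdorff_distance (X : metricType R) (A B : set X) : \bar R :=
  maxe (ereal_sup [set edist_inf B x | x in A])
       (ereal_sup [set edist_inf A y | y in B]).

Definition GH_distance (E F : metricType R) : \bar R :=
  ereal_inf [set r | exists (X : metricType R) (i : E -> X) (j : F -> X),
    [/\ isometry i, isometry j &
        r = hausdorff_distance (range i) (range j)]].

Definition class_GH_distance (C D : isometryClass) : \bar R :=
  GH_distance (representative C) (representative D).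

Lemma GH_distance_isometric (E E' F F' : metricType R) :
  isometric E E' -> isometric F F' -> GH_distance E F = GH_distance E' F'.
Proof.
suff le (A A' B B' : metricType R) : isometric A A' -> isometric B B' ->
    (GH_distance A' B' <= GH_distance A B)%E.
  by move=> EE' FF'; apply/eqP; rewrite eq_le !le//; exact: isometric_sym.
move=> /isometric_sym[f fi [f' fK f'K]] /isometric_sym[g gi [g' gK g'K]].
apply: le_ereal_inf_tmp => _ [X [i [j [ii ji ->]]]]; apply: ereal_inf_lbound.
exists X, (i \o f), (j \o g); split.
- by move=> x y /=; rewrite ii fi.
- by move=> x y /=; rewrite ji gi.
- congr hausdorff_distance; apply/seteqP; split => _ [x _ <-] /=.
  + by exists (f' x) => //=; rewrite f'K.
  + by exists (f x).
  + by exists (g' x) => //=; rewrite g'K.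
  + by exists (g x).
Qed.

Lemma class_GH_distanceE (E F : compactMetric R) :
  class_GH_distance (class_of E) (class_of F) = GH_distance E F.
Proof.
by apply: GH_distance_isometric; apply: isometric_sym;
  exact: representative_class_of.
Qed.

(* Continuity at [C] for the topology of the Gromov-Hausdorff distance.  The
   filter notation [f @ C --> f C] is not available: [isometryClass] lives in a
   universe above that of the topological structures. *)
Definition GH_continuous_at (f : isometryClass -> \bar R) (C : isometryClass) :=
  forall U, nbhs (f C) U -> exists2 e : R, 0 < e &
    forall D, (class_GH_distance C D < e%:E)%E -> U (f D).

End IsometryClasses.

Section FractionalIndex.
Variable R : realType.

Definition negative_definite_kernel (S : Type) (f : S -> S -> R) : Prop :=
  (forall x y, f x y = f y x) /\
  forall (n : nat) (x : 'I_n -> S) (c : 'I_n -> R), \sum_i c i = 0 ->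
    \sum_i \sum_j c i * c j * f (x i) (x j) <= 0.

Definition is_fractional_index (E : metricType R) (b : \bar R) : Prop :=
  (0 <= b)%E /\
  forall H : R, 0 < H ->
    negative_definite_kernel (fun x y : E => mdist x y `^ (2 * H)) <->
    ((2 * H)%:E <= b)%E.

Lemma is_fractional_index_unique (E : metricType R) (b b' : \bar R) :
  is_fractional_index E b -> is_fractional_index E b' -> b = b'.
Proof.
suff le (x y : \bar R) : is_fractional_index E x -> is_fractional_index E y ->
    (x <= y)%E.
  by move=> Eb Eb'; apply/eqP; rewrite eq_le !le.
move=> [x0 Ex] [y0 Ey]; rewrite leNgt; apply/negP => yx.
have [r yr rx] : exists2 r : R, (y < r%:E)%E & (r%:E <= x)%E.
  clear Ex Ey; case: x y x0 y0 yx => [x| |] [y| |] //= _ _ yx.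
  - by exists x.
  - by exists (y + 1); rewrite ?lte_fin ?ltrDl ?leey.
have r0 : 0 < r by rewrite -lte_fin; exact: le_lt_trans yr.
have h0 : 0 < r / 2 by rewrite divr_gt0.
have [_ xh] := Ex _ h0; have [yh _] := Ey _ h0.
by move: yh xh; rewrite mulrC divfK// leNgt yr => yh /(_ rx)/yh.
Qed.

Lemma is_fractional_index_isometric (E F : metricType R) (b : \bar R) :
  isometric E F -> is_fractional_index E b -> is_fractional_index F b.
Proof.
suff nd (A B : metricType R) (p : R) : isometric A B ->
    negative_definite_kernel (fun x y : A => mdist x y `^ p) ->
    negative_definite_kernel (fun x y : B => mdist x y `^ p).
  move=> EF [b0 Eb]; split=> // H H0; rewrite -Eb//; split; apply: nd => //.
  exact: isometric_sym.
move=> /isometric_sym[f fi _] [_ ndA]; split=> [x y|n x c c0].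
  by rewrite metric_sym.
under eq_bigr do under eq_bigr do rewrite -fi.
exact: (ndA n (f \o x)).
Qed.

(* Uniqueness of the index is [is_fractional_index_unique]; its existence for
   every metric space is classical (Schoenberg), so the default [0] plays no
   role.  Values lie in [0, +oo], whose topology is induced by that of
   [\bar R]; see [fractional_index_ge0]. *)
Definition fractional_index (E : metricType R) : \bar R :=
  xget 0%E (is_fractional_index E).

Definition class_fractional_index (C : isometryClass R) : \bar R :=
  fractional_index (representative C).

Lemma fractional_index_ge0 (E : metricType R) : (0 <= fractional_index E)%E.
Proof. by rewrite /fractional_index; case: xgetP => [b _ []|]. Qed.

Lemma class_fractional_indexE (E : compactMetric R) :
  class_fractional_index (class_of E) = fractional_index E.
Proof.
rewrite /class_fractional_index /fractional_index; congr xget.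
apply/funext => b; apply/propext; split; apply: is_fractional_index_isometric.
  by apply: isometric_sym; exact: representative_class_of.
exact: representative_class_of.
Qed.

End FractionalIndex.

(* The circle of length [2 * pi], each point being given by its angle in
   [0, 2 * pi). *)
Record circle (R : realType) := Circle {
  angle : R ;
  angleP : 0 <= angle < 2 * pi }.

HB.instance Definition _ (R : realType) := [isSub for @angle R].
HB.instance Definition _ (R : realType) := [Choice of circle R by <:].

Section Circle.
Variable R : realType.
Implicit Types x y z : circle R.

Definition circle_distance x y : R :=
  Num.min `|angle x - angle y| (2 * pi - `|angle x - angle y|).

Lemma circle_distancexx x : circle_distance x x = 0.
Proof.
by rewrite /circle_distance subrr normr0 subr0 min_l// mulr_ge0// pi_ge0.
Qed.

Lemma circle_distance_positivity x y : circle_distance x y = 0 -> x = y.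
Proof.
move=> d0; apply: val_inj => /=; apply/eqP; rewrite -subr_eq0 -normr_eq0.
move: d0; have /andP[x0 x2] := angleP x; have /andP[y0 y2] := angleP y.
rewrite /circle_distance minEle; case: ifPn => [_ ->//|_ /eqP].
rewrite subr_eq0 => /eqP d2; exfalso.
have : `|angle x - angle y| < 2 * pi by rewrite ltr_norml; lra.
by rewrite -d2 ltxx.
Qed.

Lemma circle_distance_sym x y : circle_distance x y = circle_distance y x.
Proof. by rewrite /circle_distance distrC. Qed.

Lemma circle_distance_triangle y x z :
  circle_distance x z <= circle_distance x y + circle_distance y z.
Proof.
have /andP[x0 x2] := angleP x; have /andP[y0 y2] := angleP y.
have /andP[z0 z2] := angleP z; rewrite /circle_distance !minEle.
by case: (ger0P (angle x - angle y)) => ?;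
   case: (ger0P (angle y - angle z)) => ?;
   case: (ger0P (angle x - angle z)) => ?;
   do 3 case: ifPn; rewrite -?ltNge => *; lra.
Qed.

HB.instance Definition _ := isMetric.Build R (circle R)
  circle_distancexx circle_distance_positivity circle_distance_sym
  circle_distance_triangle.

Let circle0 : circle R.
Proof.
by apply: (@Circle R 0); rewrite lexx mulr_gt0// pi_gt0.
Defined.

Lemma circle_nonempty : [set: circle R] !=set0.
Proof. by exists circle0. Qed.

Let wrap (t : R) : circle R := insubd circle0 t.

Lemma circle_compact : compact [set: circle R].
Proof.
have wrapE (t : R) : 0 <= t < 2 * pi -> angle (wrap t) = t.
  by move=> t02; rewrite /wrap -[LHS]/(val _) insubdK.
have wrap_pi : angle (wrap (2 * pi)) = 0.
  rewrite /wrap -[LHS]/(val _) val_insubd.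
  by rewrite ltxx andbF.
have -> : [set: circle R] = wrap @` `[0, 2 * pi].
  apply/seteqP; split => // x _; exists (angle x).
    by rewrite /= in_itv /=; have /andP[-> /ltW ->] := angleP x.
  by apply: val_inj => /=; rewrite wrapE// angleP.
apply: continuous_compact; last exact: segment_compact.
have lip (s t : R) : 0 <= s <= 2 * pi -> 0 <= t <= 2 * pi ->
    mdist (wrap s) (wrap t) <= `|s - t|.
  move=> /andP[s0 s2] /andP[t0 t2].
  change (circle_distance (wrap s) (wrap t) <= `|s - t|).
  rewrite /circle_distance.
  have [s2'|s2'] := ltP s (2 * pi); have [t2'|t2'] := ltP t (2 * pi).
  - by rewrite !wrapE ?s0 ?t0// ge_min lexx.
  - have -> : t = 2 * pi by apply/eqP; rewrite eq_le t2.
    rewrite wrap_pi wrapE ?s0// subr0 ger0_norm// distrC ger0_norm ?subr_ge0//.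
    by rewrite ge_min lexx orbT.
  - have -> : s = 2 * pi by apply/eqP; rewrite eq_le s2.
    rewrite wrap_pi wrapE ?t0// sub0r normrN ger0_norm// ger0_norm ?subr_ge0//.
    by rewrite ge_min lexx orbT.
  - have -> : t = 2 * pi by apply/eqP; rewrite eq_le t2.
    have -> : s = 2 * pi by apply/eqP; rewrite eq_le s2.
    by rewrite !subrr normr0 ge_min lexx.
apply/subspace_continuousP => s /=; rewrite in_itv /= => s02.
apply/metricType_numDomainType.cvgrPdist_le => e e0.
rewrite near_withinE; near=> t => /=; rewrite in_itv /= => t02.
apply: le_trans (lip _ _ s02 t02) _; near: t.
exact: (@cvgr_dist_le _ _ _ _ _ id).
Unshelve. all: by end_near. Qed.

Definition circle_space : compactMetric R :=
  CompactMetric circle_nonempty circle_compact.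

End Circle.

(* Main.v *)
Require Import Defs.
From HB Require Import structures.
From mathcomp Require Import all_boot all_order all_algebra.
From mathcomp Require Import all_classical all_reals all_analysis.
From mathcomp Require Import ring lra.

Set Implicit Arguments.
Unset Strict Implicit.
Unset Printing Implicit Defensive.

Import Order.TTheory GRing.Theory Num.Theory.
Import numFieldNormedType.Exports numFieldTopology.Exports.

Local Open Scope classical_set_scope.
Local Open Scope ring_scope.

(** The index of the circle is 1, while compact spaces arbitrarily close to the
circle have index at most 1/2.

The obstruction to a large index is the complete bipartite graph [K_{n,n}]
with its path metric, rescaled by an arbitrary factor.  The weights 1 on one
side and -1 on the other give the distance to the power [p] a quadratic form
whose sign is that of [(n - 1) 2 ^ p - n], so no space containing such a graph
isometrically has index at least [p] as soon as this is positive
([bipartite_not_nd]).  The condition does not involve the scale of the graph.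
Hence the product of a space [E] with a copy of [K_{4,4}] of diameter
[2 eps] has index at most 1/2 ([bundle_not_nd]), although it lies within
[2 eps] of [E] ([GH_distance_bundle]).

The index of the circle is at most 1 for the same reason: four equally spaced
points form a copy of [K_{2,2}].  That it is at least 1
([circle_powR_nd]) comes from two facts.

First, on finitely many distances the concave nondecreasing
function [t ^ p], [p <= 1], behaves like a combination with nonnegative
coefficients of the truncations [min (t, s)] ([concave_sum_le0]).  It is thus
enough to treat the kernels [min (d (x, y), s)] with [s <= pi].

Secondly, write [L] for the length of the circle, and let
[g (u) = |u| (L - |u|)], a function of the difference of two angles which is
well defined modulo [L].  Away from 0 it is a parabola, and at 0 it has a kink;
so its second difference of step [s] is a constant plus a multiple of
[min (d, s)] ([bridge_second_difference]).  Evaluating the quadratic form of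
[g] on points [x_i] of weight [c_i] and on their rotations by [s] with weights
[- c_i] therefore gives that of [min (d, s)], up to a positive factor
([circle_min_nd]).  Finally [g] is the variogram of the Brownian bridge, and
its negative definiteness amounts to the positivity of the covariance
[L min (x, y) - x y] ([min_kernel_ge]). *)

(** * Complete bipartite graphs as obstructions *)

Section BipartiteObstruction.
Variable R : realType.

(** Configurations are more conveniently indexed by arbitrary finite types,
such as pairs, than by ordinals. *)
Lemma nd_kernel_fin (S : Type) (f : S -> S -> R) (T : finType) (x : T -> S)
    (c : T -> R) :
  negative_definite_kernel f -> \sum_i c i = 0 ->
  \sum_i \sum_j c i * c j * f (x i) (x j) <= 0.
Proof.
move=> [_ nd] c0.
have reindexT (F : T -> R) : \sum_i F i = \sum_(k < #|T|) F (enum_val k).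
  by rewrite (reindex_onto enum_val enum_rank)/= => [|i _];
    rewrite ?enum_rankK//; apply: eq_bigl => i; rewrite enum_valK eqxx.
rewrite reindexT; under eq_bigr do rewrite reindexT.
by apply: (nd _ (x \o enum_val) (c \o enum_val)); rewrite -reindexT.
Qed.

(** The path metric of [K_{n,n}]; the boolean tells the side of a vertex. *)
Definition bipartite_distance (n : nat) (u v : bool * 'I_n) : R :=
  if u == v then 0 else if u.1 == v.1 then 2 else 1.

Section Distance.
Variable n : nat.
Implicit Types u v w : bool * 'I_n.

Lemma bipartite_distance_ge0 u v : 0 <= bipartite_distance u v.
Proof. by rewrite /bipartite_distance; case: ifP => // _; case: ifP. Qed.

Lemma bipartite_distance_le2 u v : bipartite_distance u v <= 2.
Proof. by rewrite /bipartite_distance; do 2 (case: ifP => // _); rewrite ler1n. Qed.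

Lemma bipartite_distance_sym u v :
  bipartite_distance u v = bipartite_distance v u.
Proof. by rewrite /bipartite_distance eq_sym (eq_sym u.1). Qed.

Lemma bipartite_distance_triangle v u w :
  bipartite_distance u w <= bipartite_distance u v + bipartite_distance v w.
Proof.
have [->|uv] := eqVneq u v; first by rewrite lerDr bipartite_distance_ge0.
have [->|vw] := eqVneq v w; first by rewrite lerDl bipartite_distance_ge0.
apply: le_trans (bipartite_distance_le2 _ _) _.
rewrite /bipartite_distance (negPf uv) (negPf vw).
by do 2 case: ifP => _; lra.
Qed.

End Distance.

(** Each vertex has [n - 1] vertices at distance [2 r], all with its own sign,
and [n] vertices at distance [r], all with the opposite sign: with weights
1 and -1, all the rows of the quadratic form have the same sum
[r ^ p ((n - 1) 2 ^ p - n)]. *)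
Lemma bipartite_not_nd (E : metricType R) (n : nat) (r : R)
    (z : bool * 'I_n -> E) (p : R) :
  0 < r -> 0 < p ->
  (forall u v, mdist (z u) (z v) = r * bipartite_distance u v) ->
  n%:R < n.-1%:R * 2 `^ p ->
  ~ negative_definite_kernel (fun x y : E => mdist x y `^ p).
Proof.
move=> r0 p0 zE np nd.
have n0 : (0 < n)%N by case: (n) np => //; rewrite mul0r ltxx.
pose c (u : bool * 'I_n) : R := (-1) ^+ u.1.
have pairE (F : bool * 'I_n -> R) :
    \sum_u F u = \sum_i F (true, i) + \sum_i F (false, i).
  rewrite (eq_bigr (fun u => F (u.1, u.2))) => [|[]//].
  by rewrite -(pair_bigA _ (fun b i => F (b, i))) /= big_bool.
have c0 : \sum_u c u = 0.
  by rewrite pairE /c /= expr1 expr0 !sumr_const mulNrn addNr.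
have same (b : bool) (i : 'I_n) :
    \sum_j mdist (z (b, i)) (z (b, j)) `^ p = n.-1%:R * (r `^ p * 2 `^ p).
  rewrite (bigD1 i)//= zE /bipartite_distance eqxx mulr0 powR0 ?gt_eqF// add0r.
  rewrite (eq_bigr (fun=> r `^ p * 2 `^ p)) => [|j ji].
    by rewrite sumr_const cardC1 card_ord mulr_natl.
  by rewrite zE /bipartite_distance xpair_eqE !eqxx eq_sym (negPf ji) powRM ?ltW.
have other (b : bool) (i : 'I_n) :
    \sum_j mdist (z (b, i)) (z (~~ b, j)) `^ p = n%:R * r `^ p.
  rewrite (eq_bigr (fun=> r `^ p)) => [|j _].
    by rewrite sumr_const card_ord mulr_natl.
  by rewrite zE /bipartite_distance xpair_eqE /=; case: b; rewrite mulr1.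
have row u : \sum_v c u * c v * mdist (z u) (z v) `^ p =
    r `^ p * (n.-1%:R * 2 `^ p - n%:R).
  case: u => b i; rewrite pairE /c /= -!mulr_sumr.
  case: b; [rewrite same (other true)|rewrite same (other false)];
    by rewrite /= !expr1 !expr0; ring.
have := nd_kernel_fin z nd c0.
rewrite (eq_bigr _ (fun u _ => row u)) sumr_const; apply/negP.
rewrite -ltNge pmulrn_lgt0; last by rewrite card_prod card_bool card_ord muln_gt0.
by rewrite mulr_gt0 ?powR_gt0// subr_gt0.
Qed.

End BipartiteObstruction.

(** * The variogram of the Brownian bridge *)

Section PositiveKernels.
Variable R : realType.

(** On weights of sum zero, terms depending on only one of the two points are
invisible to the quadratic form; this is what relates variograms to
covariances. *)
Lemma sum_sum_addr (T : finType) (c u v : T -> R) (k : T -> T -> R) :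
  \sum_i c i = 0 ->
  \sum_i \sum_j c i * c j * (u i + v j + k i j) =
  \sum_i \sum_j c i * c j * k i j.
Proof.
move=> c0.
transitivity (\sum_i (c i * u i * \sum_j c j + c i * \sum_j c j * v j +
                      \sum_j c i * c j * k i j)).
  apply: eq_bigr => i _; rewrite !mulr_sumr -!big_split /=.
  by apply: eq_bigr => j _; ring.
by rewrite !big_split /= -!mulr_suml c0 mulr0 mul0r !add0r.
Qed.

(** The covariance [L min (x, y) - x y] of the Brownian bridge is positive.
Let [m] be the index of the largest point.  Since
[min (x_i, x_m) = x_i] for all [i], adding [m] increases both
[(sum_i c_i x_i) ^ 2] and [x_m sum_i sum_j c_i c_j min (x_i, x_j)] by the same
amount, so the inequality with [L = x_m] follows from the one for the other
points.  It passes to [L >= x_m] because the double sum is nonnegative. *)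
Lemma min_kernel_ge (T : finType) (A : {set T}) (c x : T -> R) (L : R) :
  0 <= L -> {in A, forall i, 0 <= x i <= L} ->
  let S := \sum_(i in A) \sum_(j in A) c i * c j * Num.min (x i) (x j) in
  0 <= S /\ (\sum_(i in A) c i * x i) ^+ 2 <= L * S.
Proof.
have [n] := ubnP #|A|; elim: n A L => // n IHn A L An L0 xA /=.
have [->|[m0 m0A]] := set_0Vmem A.
  by rewrite !big_set0 expr0n mulr0.
pose m := [arg max_(i > m0 in A) x i]%O.
have [mA mmax] : m \in A /\ {in A, forall i, x i <= x m}.
  by rewrite /m; case: arg_maxP.
clearbody m; have /andP[xm0 xmL] := xA _ mA.
have [||S0] := IHn (A :\ m) (x m) _ xm0.
- by move: An; rewrite (cardsD1 m) mA.
- by move=> i; rewrite !inE => /andP[_ iA]; rewrite mmax//; case/andP: (xA _ iA) => ->.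
move: S0; set S := (X in 0 <= X); set t := (X in X ^+ 2 <= _) => S0 tS.
rewrite (big_setD1 m mA) /= (big_setD1 m mA) /= minxx.
rewrite (eq_bigr (fun j => c m * (c j * x j))); last first.
  by move=> j; rewrite !inE => /andP[_ jA]; rewrite min_r ?mmax//; ring.
rewrite -mulr_sumr -/t.
rewrite [X in _ + X](eq_bigr (fun i => c m * (c i * x i) +
    \sum_(j in A :\ m) c i * c j * Num.min (x i) (x j))); last first.
  move=> i; rewrite !inE => /andP[_ iA].
  by rewrite (big_setD1 m mA) /= min_l ?mmax//; ring.
rewrite big_split /= -mulr_sumr -/t -/S (big_setD1 m mA) /= -/t.
set S2 := (X in 0 <= X /\ _).
have S2E : S2 = c m ^+ 2 * x m + 2 * c m * t + S by rewrite /S2; ring.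
have le2 : (c m * x m + t) ^+ 2 <= x m * S2.
  rewrite S2E -subr_ge0.
  suff -> : x m * (c m ^+ 2 * x m + 2 * c m * t + S) - (c m * x m + t) ^+ 2 =
     x m * S - t ^+ 2 by rewrite subr_ge0.
  by ring.
(* If [x m = 0] then all the points are zero and [S2] reduces to [S]. *)
suff S20 : 0 <= S2.
  by split=> //; apply: le_trans le2 _; exact: ler_wpM2r.
move: xm0; rewrite le_eqVlt => /orP[/eqP xm0|xm0].
  move: tS; rewrite -xm0 mul0r => t0.
  have /eqP : t ^+ 2 = 0 by apply/eqP; rewrite eq_le t0 sqr_ge0.
  by rewrite sqrf_eq0 S2E => /eqP ->; rewrite -xm0 !mulr0 !add0r.
by rewrite -(pmulr_rge0 _ xm0); apply: le_trans le2; exact: sqr_ge0.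
Qed.

(** With [u (t) = L t - t ^ 2], the kernel is
[u (x) + u (y) - 2 (L min (x, y) - x y)]. *)
Lemma bridge_variogram_nd (T : finType) (c x : T -> R) (L : R) :
  0 <= L -> (forall i, 0 <= x i <= L) -> \sum_i c i = 0 ->
  \sum_i \sum_j c i * c j * (`|x i - x j| * (L - `|x i - x j|)) <= 0.
Proof.
move=> L0 xL c0; pose u t : R := L * t - t ^+ 2.
have kE i j : `|x i - x j| * (L - `|x i - x j|) = u (x i) + u (x j) +
    (2 * (x i * x j) - 2 * L * Num.min (x i) (x j)).
  by rewrite /u; case: ger0P => ?; [rewrite min_r|rewrite min_l]; try lra; ring.
under eq_bigr do under eq_bigr do rewrite kE.
rewrite (sum_sum_addr (u \o x) (u \o x))//.
(* The double sums of the lemma range over a set, those of the goal over a type. *)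
have [_] := @min_kernel_ge T [set: T]%SET c x L L0 (fun i _ => xL i).
have inT (F : T -> R) : \sum_(i in [set: T]%SET) F i = \sum_i F i.
  by apply: eq_bigl => i; rewrite inE.
rewrite !inT expr2 mulr_suml mulr_sumr -subr_ge0 -sumrB => le.
rewrite -oppr_ge0 -(pmulr_rge0 _ (ltr0Sn R 1)).
apply: le_trans (mulr_ge0 (ler0n R 4) le) _; rewrite le_eqVlt; apply/orP; left.
apply/eqP; rewrite -sumrN !mulr_sumr; apply: eq_bigr => i _.
rewrite inT -sumrN !mulr_sumr -sumrB mulr_sumr; apply: eq_bigr => j _.
by ring.
Qed.

End PositiveKernels.

(** * Concave functions and truncations *)

Section ConcaveFunctions.
Variable R : realType.

Lemma path_le_last (x : R) (ts : seq R) :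
  path <%R x ts -> {in x :: ts, forall s, s <= last x ts}.
Proof.
elim: ts x => [|y ts IH] x /=; first by move=> _ s; rewrite inE => /eqP ->.
move=> /andP[xy yts] s; rewrite inE => /orP[/eqP ->|/(IH _ yts)//].
by apply: le_trans (ltW xy) _; apply: IH; rewrite ?mem_head.
Qed.

(** On a finite set of nonnegative reals containing 0, a concave nondecreasing
function vanishing at 0 is a combination with nonnegative coefficients of the
functions [min (., s)].  The statement is the dual form of this fact: a signed
sum of point evaluations that is nonpositive on the latter is nonpositive on
the former.  This form makes it possible to remove the largest value [m]:
let [l] be the preceding value and [sl] the slope of [g] between [l] and [m].
Then [g (t) - sl min (t, m)] is still concave, has the same value at [l] and
[m], hence depends only on [min (t, l)], and is nondecreasing up to [l]. *)
Lemma concave_sum_le0 (I : finType) (w t : I -> R) (ts : seq R) (g : R -> R) :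
  path <%R 0 ts -> (forall i, t i \in 0 :: ts) -> g 0 = 0 ->
  {in 0 :: ts &, {homo g : u v / u <= v}} ->
  {in 0 :: ts & &, forall u v z, u < v -> v < z ->
     (g z - g v) * (v - u) <= (g v - g u) * (z - v)} ->
  {in ts, forall s, \sum_i w i * Num.min (t i) s <= 0} ->
  \sum_i w i * g (t i) <= 0.
Proof.
elim/last_ind: ts t g => [|ts m IH] t g.
  move=> _ t0 g0 _ _ _; rewrite big1// => i _.
  by move: (t0 i); rewrite inE => /eqP ->; rewrite g0 mulr0.
rewrite rcons_path => /andP[ts_lt]; set l := last 0 ts => lm tP g0 gm gc wm.
have lts : l \in 0 :: ts by exact: mem_last.
have sub s : s \in 0 :: ts -> s \in 0 :: rcons ts m.
  by rewrite !inE mem_rcons inE => /orP[] ->; rewrite ?orbT.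
have mts : m \in 0 :: rcons ts m by rewrite inE mem_rcons mem_head orbT.
have lel s : s \in 0 :: ts -> s <= l by exact: path_le_last.
have l0 : 0 <= l by apply: lel; rewrite mem_head.
have tE i : t i = m \/ t i \in 0 :: ts.
  move: (tP i); rewrite !inE mem_rcons inE.
  by case/or3P => [->|/eqP|->]; rewrite ?orbT; [right|left|right].
pose sl := (g m - g l) / (m - l).
have ml0 : 0 < m - l by rewrite subr_gt0.
have sl0 : 0 <= sl.
  rewrite divr_ge0// subr_ge0 ?(ltW lm)//.
  by apply: gm; [exact: sub| |exact: ltW].
have slE : sl * (m - l) = g m - g l by rewrite divfK// gt_eqF.
have -> : \sum_i w i * g (t i) =
    \sum_i w i * (g (Num.min (t i) l) - sl * Num.min (t i) l) +
    sl * \sum_i w i * Num.min (t i) m.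
  rewrite mulr_sumr -big_split /=; apply: eq_bigr => i _.
  have [->|ti] := tE i.
    rewrite min_r ?(ltW lm)// minxx.
    transitivity (w i * (g l - sl * l + sl * m)); last by ring.
    by congr (_ * _); move: slE; lra.
  by rewrite !min_l ?lel// ?(le_trans (lel _ ti) (ltW lm))//; ring.
have wm0 : \sum_i w i * Num.min (t i) m <= 0.
  by apply: wm; rewrite mem_rcons mem_head.
rewrite -[leRHS]addr0 lerD// ?mulr_ge0_le0//.
apply: (IH (fun i => Num.min (t i) l) (fun s => g s - sl * s)) => //.
- move=> i; have [->|ti] := tE i; first by rewrite min_r// ltW.
  by rewrite min_l// lel.
- by rewrite g0 mulr0 subr0.
- move=> u v uts vts; rewrite le_eqVlt => /orP[/eqP ->//|uv].
  have vm : v < m by apply: le_lt_trans lm; exact: lel.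
  have slv : sl * (m - v) <= g m - g v.
    have := lel _ vts; rewrite le_eqVlt => /orP[/eqP ->|vl].
      by rewrite slE.
    have := gc _ _ _ (sub _ vts) (sub _ lts) mts vl lm.
    by rewrite -slE mulrAC ler_pM2r// => h; move: slE h; lra.
  have := gc _ _ _ (sub _ uts) (sub _ vts) mts uv vm.
  move=> h; have {}h : sl * (v - u) * (m - v) <= (g v - g u) * (m - v).
    apply: le_trans h; rewrite mulrAC ler_wpM2r// subr_ge0 ltW//.
  by move: h; rewrite ler_pM2r ?subr_gt0//; lra.
- move=> u v z uts vts zts uv vz.
  by have := gc _ _ _ (sub _ uts) (sub _ vts) (sub _ zts) uv vz; lra.
- move=> s sts; have := wm s; rewrite mem_rcons inE sts orbT => /(_ erefl).
  under [X in _ -> X <= _]eq_bigr => i _.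
    rewrite -minA (@min_r _ _ l s); first over.
    by apply: lel; rewrite inE sts orbT.
  by [].
Qed.

(** Concavity of [t ^ p] as a decrease of the slopes of chords, deduced from
the convexity of the reciprocal function [t ^ (1 / p)] applied to [u ^ p] and
[z ^ p]. *)
Lemma concave_powR (p u v z : R) : 0 < p -> p <= 1 ->
  0 <= u -> u < v -> v < z ->
  (z `^ p - v `^ p) * (v - u) <= (v `^ p - u `^ p) * (z - v).
Proof.
move=> p0 p1 u0 uv vz.
have zu : 0 < z - u by lra.
pose t := (v - u) / (z - u).
have t0 : 0 <= t by rewrite divr_ge0; lra.
have t1 : t <= 1 by rewrite ler_pdivrMr//; lra.
pose q := p^-1.
have q1 : 1 <= q by rewrite invf_ge1.
have pK (a : R) : 0 <= a -> (a `^ p) `^ q = a.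
  by move=> a0; rewrite -powRrM mulfV ?powRr1// gt_eqF.
have := @convex_powR R q q1 (Itv01 t0 t1) (z `^ p) (u `^ p).
rewrite !inE /= !in_itv /= !andbT => /(_ (powR_ge0 _ _) (powR_ge0 _ _)).
rewrite convRE [X in X `^ _ <= _]convRE /= !pK//; last by lra.
set A := (X in X `^ _) => h.
have tv : t * (z - u) = v - u by rewrite divfK// gt_eqF.
have A0 : 0 <= A by rewrite addr_ge0// mulr_ge0// ?powR_ge0// subr_ge0.
have : A <= v `^ p.
  rewrite -[A]powRr1// -[X in _ `^ X](@mulVf _ p) ?gt_eqF// powRrM.
  rewrite ge0_ler_powR ?nnegrE ?powR_ge0 ?(ltW p0)//; first by lra.
  by apply: le_trans h _; rewrite /unstable.onem; lra.
rewrite /A /unstable.onem => {}h.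
have : (z `^ p - u `^ p) * (v - u) <= (v `^ p - u `^ p) * (z - u).
  rewrite -tv mulrCA mulrA ler_wpM2r ?(ltW zu)//.
  by move: h; lra.
lra.
Qed.
End ConcaveFunctions.

(** * The fractional index of the circle *)

Section CircleIndex.
Variable R : realType.
Implicit Types (s : R) (x y : circle R).

Definition rotate_angle (L s a : R) : R := if a + s < L then a + s else a + s - L.

(** The left-hand side is minus the second difference of step [s] of
[|u| (L - |u|)] at [u = a - b], because this function of [u] is unchanged when
an angle is reduced modulo [L].  If the geodesic distance [d] between [a] and
[b] is at least [s], only the quadratic part contributes and the result is
[2 s ^ 2]; otherwise the kink at 0 subtracts [2 L (s - d)]. *)
Lemma bridge_second_difference (L s a b : R) :
  0 <= a < L -> 0 <= b < L -> 0 <= s <= L / 2 ->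
  let g u v := `|u - v| * (L - `|u - v|) in
  let r := rotate_angle L s in
  g a b + g (r a) (r b) - g (r a) b - g a (r b) =
  2 * L * Num.min (Num.min `|a - b| (L - `|a - b|)) s + (2 * s ^+ 2 - 2 * L * s).
Proof.
move=> /andP[a0 aL] /andP[b0 bL] /andP[s0 sL] /=; rewrite /rotate_angle.
wlog ab : a b a0 b0 aL bL / b <= a => [H|].
  have [/H->//|/ltW ab] := leP b a.
  rewrite (distrC a) (distrC (if a + s < L then _ else _)) (distrC _ b).
  by rewrite (distrC _ (if b + s < L then _ else _)) -H//; ring.
rewrite (ger0_norm (_ : 0 <= a - b)) ?subr_ge0//.
rewrite [Num.min _ (L - _)]minEle.
case: (leP (a - b) (L - (a - b))) => hd; rewrite minEle; case: (leP _ s) => hs;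
case: (ltP (a + s) L) => asL; case: (ltP (b + s) L) => bsL; try lra.
all: do 3 (case: ger0P => ?); try lra.
(* What remains are cases where two branches meet: first [d = s], then also
   [s = L / 2]. *)
all: have sE : s = a - b by lra.
all: try by rewrite sE; ring.
all: have LE : L = 2 * (a - b) by lra.
all: try by rewrite sE LE; ring.
Qed.

Lemma circle_mdistE x y : mdist x y =
  Num.min `|angle x - angle y| (2 * pi - `|angle x - angle y|).
Proof. by []. Qed.

Lemma circle_mdist_le_pi x y : mdist x y <= pi.
Proof. by rewrite circle_mdistE ge_min; case: leP => //= ?; lra. Qed.

(** Test the negative definite kernel [|u| (L - |u|)] on the points [x i]
together with their rotations by [s], the latter with opposite weights. *)
Lemma circle_min_nd (T : finType) (c : T -> R) (x : T -> circle R) s :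
  0 <= s <= pi -> \sum_i c i = 0 ->
  \sum_i \sum_j c i * c j * Num.min (mdist (x i) (x j)) s <= 0.
Proof.
move=> s0pi c0; pose L : R := 2 * pi; have pi0 := pi_gt0 R.
pose y (p : T * bool) := if p.2 then rotate_angle L s (angle (x p.1))
                         else angle (x p.1).
pose d (p : T * bool) := if p.2 then - c p.1 else c p.1.
have L0 : 0 <= L by rewrite /L; lra.
have yL p : 0 <= y p <= L.
  have /andP[a0 aL] := angleP (x p.1); have /andP[s0 sp] := s0pi.
  rewrite /y /rotate_angle /L; case: p.2; last by lra.
  by case: ltP => ?; lra.
have pairE (F : T * bool -> R) : \sum_p F p = \sum_i (F (i, true) + F (i, false)).
  rewrite (eq_bigr (fun p => F (p.1, p.2))) => [|[]//].
  rewrite -(pair_bigA _ (fun i b => F (i, b))) /=.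
  by apply: eq_bigr => i _; rewrite big_bool.
have d0 : \sum_p d p = 0.
  by rewrite pairE big1// => i _; rewrite /d /= addNr.
have := bridge_variogram_nd L0 yL d0.
pose F p q := d p * d q * (`|y p - y q| * (L - `|y p - y q|)).
have FE i j : F (i, true) (j, true) + F (i, true) (j, false) +
    (F (i, false) (j, true) + F (i, false) (j, false)) =
    2 * L * (c i * c j * Num.min (mdist (x i) (x j)) s) +
    c i * ((2 * s ^+ 2 - 2 * L * s) * c j).
  transitivity (c i * c j * (2 * L * Num.min (mdist (x i) (x j)) s +
      (2 * s ^+ 2 - 2 * L * s))); last by ring.
  rewrite circle_mdistE -bridge_second_difference ?angleP//; last by rewrite /L; lra.
  by rewrite /F /y /d /=; ring.
rewrite -/(\sum_p \sum_q F p q) pairE.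
under eq_bigr => i _.
  rewrite !pairE -big_split /= (eq_bigr _ (fun j _ => FE i j)) big_split /=.
  rewrite -!mulr_sumr c0 !mulr0 addr0.
  over.
by rewrite -mulr_sumr pmulr_rle0// /L; lra.
Qed.

(** The signed sum of evaluations to which [concave_sum_le0] is applied is
indexed by the pairs of points, and [ts] lists their nonzero distances. *)
Lemma circle_powR_nd (T : finType) (c : T -> R) (x : T -> circle R) (p : R) :
  0 < p -> p <= 1 -> \sum_i c i = 0 ->
  \sum_i \sum_j c i * c j * mdist (x i) (x j) `^ p <= 0.
Proof.
move=> p0 p1 c0.
pose w (k : T * T) := c k.1 * c k.2; pose t (k : T * T) := mdist (x k.1) (x k.2).
pose ts := sort <=%R (undup [seq t k | k <- enum {: T * T} & 0 < t k]).
have tsP s : s \in ts -> exists2 k, s = t k & 0 < t k.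
  rewrite mem_sort mem_undup => /mapP[k]; rewrite mem_filter => /andP[tk _] ->.
  by exists k.
have ts_lt : path <%R 0 ts.
  rewrite path_sortedE; last exact: lt_trans.
  rewrite lt_sorted_uniq_le sort_uniq undup_uniq sort_le_sorted !andbT.
  by apply/allP => s /tsP[k ->].
have tts k : t k \in 0 :: ts.
  rewrite inE mem_sort mem_undup; have := mdist_ge0 (x k.1) (x k.2).
  rewrite -/(t k) le_eqVlt => /orP[/eqP <-|tk]; first by rewrite eqxx.
  by rewrite map_f ?orbT// mem_filter tk mem_enum.
have ts0 s : s \in 0 :: ts -> 0 <= s.
  by rewrite inE => /orP[/eqP ->//|/tsP[k -> /ltW]].
have := @concave_sum_le0 R _ w t ts (@powR R ^~ p) ts_lt tts.
rewrite /= powR0 ?gt_eqF// => /(_ erefl).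
rewrite -(pair_bigA _ (fun i j => w (i, j) * t (i, j) `^ p)) /=; apply.
- move=> u v /ts0 u0 /ts0 v0 uv.
  by rewrite ge0_ler_powR ?nnegrE// ltW.
- by move=> u v z /ts0 u0 _ _ uv vz; exact: concave_powR.
- move=> s /tsP[k sE sk].
  rewrite -(pair_bigA _ (fun i j => w (i, j) * Num.min (t (i, j)) s)) /=.
  apply: (@circle_min_nd T c x s _ c0).
  by rewrite sE (ltW sk) circle_mdist_le_pi.
Qed.


(** Four equally spaced points, numbered in circular order, are the vertices of
[K_{2,2}] scaled by [pi / 2]: the parity gives the side. *)
Lemma circle_not_nd (p : R) : 1 < p ->
  ~ negative_definite_kernel (fun x y : circle R => mdist x y `^ p).
Proof.
move=> p1; have pi0 := pi_gt0 R.
have aP (u : bool * 'I_2) : 0 <= (pi / 2 * (2 * u.2%:R + u.1%:R) : R) < 2 * pi.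
  by case: u => [b [[|[|//]] ?]]; case: b => /=; apply/andP; split; lra.
apply: (@bipartite_not_nd _ _ 2 (pi / 2) (fun u => Circle (aP u))).
- by rewrite divr_gt0.
- by rewrite (lt_trans ltr01).
- move=> [b i] [b' i']; rewrite circle_mdistE /= /bipartite_distance xpair_eqE /=.
  by case: i => [[|[|//]] ?]; case: i' => [[|[|//]] ?]; case: b; case: b'; 
     rewrite /= /eq_op /= minEle; case: ger0P => ?; case: ifPn => ?; lra.
- by rewrite mul1r -[ltLHS]powRr1// /powR pnatr_eq0 ltr_expR ltr_pM2r ?ln_gt0 ?ltr1n.
Qed.

Lemma circle_fractional_index : is_fractional_index (circle R) 1%E.
Proof.
split=> // H H0; rewrite lee_fin; split=> [nd|H1].
  by rewrite leNgt; apply/negP => H1; exact: (circle_not_nd H1).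
split=> [x y|n x c c0]; first by rewrite metric_sym.
by apply: circle_powR_nd => //; rewrite mulr_gt0.
Qed.

End CircleIndex.

(** * Products with a small bipartite graph *)

(** The product of [E] with [K_{n,n}] scaled by [eps], with the sum of the two
distances.  It has a name of its own because pairs already carry the maximum
distance. *)
Definition bipartite_bundle (R : realType) (E : metricType R) (n : nat)
  (eps : {posnum R}) : Type := (E * (bool * 'I_n))%type.

HB.instance Definition _ (R : realType) (E : metricType R) (n : nat)
  (eps : {posnum R}) := Choice.copy (bipartite_bundle E n eps)
    (E * (bool * 'I_n))%type.

Section Bundle.
Variables (R : realType) (E : metricType R) (n : nat) (eps : {posnum R}).
Local Notation bundle := (bipartite_bundle E n eps).
Implicit Types (x y z : bundle) (u : bool * 'I_n).

Definition bundle_distance x y : R :=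
  mdist x.1 y.1 + eps%:num * bipartite_distance R x.2 y.2.

Lemma bundle_distancexx x : bundle_distance x x = 0.
Proof. by rewrite /bundle_distance mdistxx /bipartite_distance eqxx mulr0 addr0. Qed.

Lemma bundle_distance_positivity x y : bundle_distance x y = 0 -> x = y.
Proof.
move/eqP; rewrite paddr_eq0 ?mdist_ge0 ?mulr_ge0 ?bipartite_distance_ge0//.
case: x y => [x u] [y v] /= /andP[/eqP/mdist_positivity ->].
rewrite mulf_eq0 gt_eqF//= /bipartite_distance.
by have [->//|_] := eqVneq u v; case: ifP; rewrite (pnatr_eq0, oner_eq0).
Qed.

Lemma bundle_distance_sym x y : bundle_distance x y = bundle_distance y x.
Proof. by rewrite /bundle_distance metric_sym bipartite_distance_sym. Qed.

Lemma bundle_distance_triangle y x z :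
  bundle_distance x z <= bundle_distance x y + bundle_distance y z.
Proof.
rewrite /bundle_distance addrACA -mulrDr lerD ?metric_triangle//.
by rewrite ler_wpM2l// bipartite_distance_triangle.
Qed.

HB.instance Definition _ := isMetric.Build R bundle
  bundle_distancexx bundle_distance_positivity bundle_distance_sym
  bundle_distance_triangle.

Lemma bundle_mdistE x y :
  mdist x y = mdist x.1 y.1 + eps%:num * bipartite_distance R x.2 y.2.
Proof. by []. Qed.

Definition bundle_section u (a : E) : bundle := (a, u).

Lemma bundle_section_isometry u : Defs.isometry (bundle_section u).
Proof.
by move=> a b; rewrite bundle_mdistE /= /bipartite_distance eqxx mulr0 addr0.
Qed.

End Bundle.

Lemma isometry_continuous (R : realType) (E F : metricType R) (f : E -> F) :
  Defs.isometry f -> continuous f.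
Proof.
move=> fi x; apply/metricType_numDomainType.cvgrPdist_le => e e0; near=> y.
rewrite fi; near: y.
exact: (@metricType_numDomainType.cvgr_dist_le _ _ _ _ _ id).
Unshelve. all: by end_near. Qed.

Lemma bundle_compact (R : realType) (E : compactMetric R) (n : nat)
    (eps : {posnum R}) : compact [set: bipartite_bundle E n eps].
Proof.
have -> : [set: bipartite_bundle E n eps] =
    \big[setU/set0]_(u <- enum {: bool * 'I_n}) range (@bundle_section R E n eps u).
  rewrite -bigcup_seq; apply/seteqP; split=> // -[a u] _.
  by exists u; [rewrite /= mem_enum|exists a].
apply: bigsetU_compact => u _; apply: continuous_compact; last exact: cms_compact.
by apply: continuous_subspaceT; apply: isometry_continuous; exact: bundle_section_isometry.
Qed.

Definition bundle_space (R : realType) (E : compactMetric R) (n : nat)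
    (eps : {posnum R}) : compactMetric R.
Proof.
apply: (@CompactMetric R (bipartite_bundle E n.+1 eps) _ (@bundle_compact R E n.+1 eps)).
by have [a _] := cms_nonempty E; exists (a, (true, ord0)).
Defined.

(** The space [E] embeds as one section of the product, and every point of the
product lies in a fiber, of diameter at most [2 eps], meeting this section.
The number of vertices is written [n.+1] since the product must be
nonempty. *)
Lemma GH_distance_bundle (R : realType) (E : compactMetric R) (n : nat)
    (eps : {posnum R}) :
  (GH_distance E (bundle_space E n eps) <= (2 * eps%:num)%:E)%E.
Proof.
pose i := @bundle_section R E n.+1 eps (true, ord0).
have le0 : (0 <= (2 * eps%:num)%:E)%E by rewrite lee_fin.
apply: le_trans (_ : hausdorff_distance (range i) (range (@id (bundle_space E n eps)))
   <= _)%E.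
  apply: ereal_inf_lbound; exists (bundle_space E n eps), i, id; split => //.
  exact: bundle_section_isometry.
rewrite /hausdorff_distance ge_max; apply/andP; split;
  apply: ge_ereal_sup => _ [x _ <-].
  by rewrite edist_inf0//; exists x.
apply: le_trans (_ : edist (x, i x.1) <= _)%E.
  by apply: ereal_inf_lbound; exists (i x.1) => //; exists x.1.
rewrite edistE lee_fin bundle_mdistE mdistxx add0r mulrC.
by rewrite ler_wpM2r// bipartite_distance_le2.
Qed.

(** Any fiber is a copy of [K_{4,4}], and [4 < 3 * sqrt 2]. *)
Lemma bundle_not_nd (R : realType) (E : compactMetric R) (eps : {posnum R}) :
  ~ negative_definite_kernel
      (fun x y : bundle_space E 3 eps => mdist x y `^ (1 / 2)).
Proof.
have [a _] := cms_nonempty E.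
apply: (@bipartite_not_nd R _ 4 eps%:num
  (fun u => bundle_section eps u a : bundle_space E 3 eps)) => //.
  by move=> u v; rewrite bundle_mdistE mdistxx add0r.
rewrite div1r powR12_sqrt//=.
have s2 : Num.sqrt 2 ^+ 2 = 2 :> R by rewrite sqr_sqrtr.
have s0 : 0 <= Num.sqrt 2 :> R by exact: sqrtr_ge0.
by rewrite ltNge; apply/negP => h; nra.
Qed.

(** * Discontinuity at the circle *)

Theorem theorem6 (R : realType) :
  ~ GH_continuous_at (@class_fractional_index R) (class_of (circle_space R)).
Proof.
have circle1 : class_fractional_index (class_of (circle_space R)) = 1%E.
  rewrite class_fractional_indexE /fractional_index.
  case: xgetP => [b _ cb|/(_ 1%E)/(_ (circle_fractional_index R))//].
  exact: is_fractional_index_unique cb (circle_fractional_index R).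
move=> /(_ [set b | ((1 / 2)%:E < b)%E]); rewrite circle1 => -[|e e0].
  by apply: open_ereal_gt'; rewrite lte_fin; lra.
have e4 : 0 < e / 4 by rewrite divr_gt0.
pose B := bundle_space (circle_space R) 3 (PosNum e4).
have close : (class_GH_distance (class_of (circle_space R)) (class_of B) < e%:E)%E.
  rewrite class_GH_distanceE; apply: le_lt_trans (GH_distance_bundle _ _ _) _.
  by rewrite lte_fin /=; lra.
move=> /(_ _ close); rewrite /= class_fractional_indexE /fractional_index.
(* The default value 0 also lies outside the neighborhood. *)
case: xgetP => [b _ [_ bP] b2|_]; last by rewrite lte_fin; lra.
have h0 : 0 < 1 / 4 :> R by lra.
apply: (@bundle_not_nd R (circle_space R) (PosNum e4)).
have -> : 1 / 2 = 2 * (1 / 4) :> R by lra.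
apply/bP => //; apply/ltW.
by have -> : 2 * (1 / 4) = 1 / 2 :> R by lra.
Qed.
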